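(* Let $(M,E)$ be a Finsler space with Chern connection $\overset{\ast}{D}$. The $h$-curvature $\overset{\ast}{R}$, $hv$-curvature $\overset{\ast}{P}$ and $v$-curvature $\overset{\ast}{Q}$ of $\overset{\ast}{D}$ are given, for all $X,Y,Z\in\mathfrak{X}(TM)$, by: (a) $\overset{\ast}{R}(X,Y)Z=R(X,Y)Z-\mathcal{C}(F\mathfrak{R}(X,Y),Z)$; (b) $\overset{\ast}{P}(X,Y)Z=\overset{\circ}{P}(X,Y)Z-(\overset{\ast}{D}_{JY}\mathcal{C}')(X,Z)$; (c) $\overset{\ast}{Q}(X,Y)Z=0$, where $R$ is the $h$-curvature of the Cartan connection and $\overset{\circ}{P}$ is the $hv$-curvature of the Berwald connection.
   Context: Setting. $M$ is a real $C^\infty$ manifold of finite dimension $n$, $TM$ its tangent bundle, $\mathcal{T}M$ the bundle of nonzero tangent vectors. $J$ is the natural almost-tangent structure (vertical endomorphism) of $TM$ (locally $J(\partial/\partial x^i)=\partial/\partial y^i$, $J(\partial/\partial y^i)=0$) and $C=y^i\partial/\partial y^i$ is the Liouville vector field. Brackets of vector forms are Frölicher-Nijenhuis brackets; for a vector $1$-form $L$ and vector field $X$, $[X,L]Y=[X,LY]-L[X,Y]$, $[L,X]=-[X,L]$. Finsler space $(M,E)$: $E:TM\to\mathbb{R}$ with $E>0$ on $\mathcal{T}M$, $E(0)=0$, $E$ $C^\infty$ on $\mathcal{T}M$ and $C^1$ on $TM$, $\mathcal{L}_CE=2E$, and $\Omega:=dd_JE$ of maximal rank, where $d_JE(X)=dE(JX)$.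 Canonical spray $S$: $i_S\Omega=-dE$. Barthel connection: $\Gamma=[J,S]$, with projectors $h=\frac12(I+\Gamma)$, $v=\frac12(I-\Gamma)$; its curvature is $\mathfrak{R}=-\frac12[h,h]$, i.e. $\mathfrak{R}(X,Y)=-v[hX,hY]$. The almost-complex structure $F$ is defined by $FJ=h$, $Fh=-J$; the metric is $g(X,Y)=\Omega(X,FY)$, and $(J^*g)(Y,Z)=g(JY,JZ)$. $\mathcal{C}$ and $\mathcal{C}'$ are the symmetric vertical-valued bilinear tensors defined by $\Omega(\mathcal{C}(X,Y),Z)=\frac12(\mathcal{L}_{JX}(J^*g))(Y,Z)$ and $\Omega(\mathcal{C}'(X,Y),Z)=\frac12(\mathcal{L}_{hX}g)(JY,JZ)$. Regularity convention: objects built from $E$ are smooth only on $\mathcal{T}M$; linear connections on $TM$ and vector fields in $\mathfrak{X}(TM)$ are understood on $\mathcal{T}M$. Berwald connection $\overset{\circ}{D}$: the linear connection determined by $\overset{\circ}{D}_{JX}JY=J[JX,Y]$, $\overset{\circ}{D}_{hX}JY=v[hX,JY]$, $\overset{\circ}{D}F=0$. Cartan connection $D$: the linear connection determined by $D_{JX}JY=\overset{\circ}{D}_{JX}JY+\mathcal{C}(X,Y)$, $D_{hX}JY=\overset{\circ}{D}_{hX}JY+\mathcal{C}'(X,Y)$, $DF=0$. Chern connection: the unique linear connection $\overset{\ast}{D}$ on $TM$ such that $\overset{\ast}{D}J=0$, $\overset{\ast}{D}C=v$, $\overset{\ast}{D}\Gamma=0$, $\overset{\ast}{D}_{JX}JY=J[JX,Y]$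 (i.e. a normal lift of $\Gamma$), $\overset{\ast}{D}_{hX}g=0$, and $J\,\overset{\ast}{T}(hX,hY)=0$ for all $X,Y$, where $\overset{\ast}{T}$ is its classical torsion. Explicitly it is determined by $\overset{\ast}{D}_{JX}JY=J[JX,Y]$, $\overset{\ast}{D}_{hX}JY=v[hX,JY]+\mathcal{C}'(X,Y)$, $\overset{\ast}{D}F=0$. Curvatures: for a linear connection $\nabla$ with classical curvature $K(X,Y)Z=\nabla_X\nabla_YZ-\nabla_Y\nabla_XZ-\nabla_{[X,Y]}Z$, the $h$-, $hv$- and $v$-curvatures are the tensors $(X,Y,Z)\mapsto K(hX,hY)JZ$, $K(hX,JY)JZ$, $K(JX,JY)JZ$ respectively. They are denoted $\overset{\ast}{R},\overset{\ast}{P},\overset{\ast}{Q}$ for Chern, $R,P,Q$ for Cartan, and $\overset{\circ}{R},\overset{\circ}{P}$ ($h$- and $hv$-) for Berwald. The covariant derivative of $\mathcal{C}'$ is the usual one: $(\nabla_W\mathcal{C}')(X,Z)=\nabla_W(\mathcal{C}'(X,Z))-\mathcal{C}'(\nabla_WX,Z)-\mathcal{C}'(X,\nabla_WZ)$. *)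

(* Defs.v *)
From HB Require Import structures.
From mathcomp Require Import all_boot all_order all_algebra.
From mathcomp Require Import all_classical all_reals all_analysis.
From mathcomp Require Import ring.

Set Implicit Arguments.
Unset Strict Implicit.
Unset Printing Implicit Defensive.
Import Order.TTheory GRing.Theory Num.Theory.
Import numFieldNormedType.Exports.
Local Open Scope classical_set_scope.
Local Open Scope ring_scope.

(* Meant for A open and V finite-dimensional, where f is C^(k+1) on A iff it is
   differentiable there and x |-> 'd f x v is C^k on A for every v. *)
Fixpoint Ck (R : realType) (V W : normedModType R) (k : nat) (A : set V)
    (f : V -> W) : Prop :=
  match k with
  | 0%N => forall x, A x -> {for x, continuous f}
  | k'.+1 => (forall x, A x -> differentiable f x) /\
             (forall v, Ck k' A (fun x => 'd f x v))
  end.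

Definition smooth_on (R : realType) (V W : normedModType R) (A : set V)
  (f : V -> W) : Prop := forall k, Ck k A f.

Section CkTheory.
Context {R : realType} {V : normedModType R}.
Implicit Types (f g : V -> R) (A : set V).

Lemma diff_near0 f (x : V) : (\near x, f x = 0) -> is_diff x f 0.
Proof.
move=> f0.
have fE : f \o shift x = cst (f x) + \0 +o_ (0 : V) id.
  apply/eqaddoP => e e0.
  have : \forall z \near (0 : V), f (z + x) = 0.
    have := f0; rewrite (near_shift 0 x (fun z => f z = 0)) subr0.
    exact: filterS.
  apply: filterS => z fz; rewrite !fctE /= fz (nbhs_singleton f0) !addr0 subrr.
  by rewrite normr0 mulr_ge0 // ltW.
have c0 : continuous (\0 : V -> R) by exact: cst_continuous.
have df0 : 'd f x = \0 :> (V -> R) by exact: diff_unique.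
apply: DiffDef => //; apply/diff_locallyP; rewrite df0; split => //.
Qed.

Lemma near_eq_diff f g (x : V) : (\near x, f x = g x) ->
  differentiable f x -> is_diff x g ('d f x).
Proof.
move=> fg df; have -> : g = f + (g - f) by rewrite addrC subrK.
have h0 : is_diff x (g - f) 0.
  by apply: diff_near0; apply: filterS fg => z fgz; rewrite !fctE fgz subrr.
have := is_diffD (differentiableP df) h0.
by rewrite addr0.
Qed.

Lemma eq_Ck k A f g : open A -> (forall x, A x -> f x = g x) ->
  Ck k A f -> Ck k A g.
Proof.
move=> oA; elim: k f g => [|k IH] f g fg /=.
  move=> cf x Ax; have fgx : \near x, f x = g x.
    by apply: filterS (open_nbhs_nbhs (conj oA Ax)) => z /fg.
  have := cf x Ax; rewrite /prop_for /continuous_at (fg x Ax).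
  by apply: cvg_trans; apply: near_eq_cvg; apply: filterS fgx => z ->.
have fgx x : A x -> \near x, f x = g x.
  by move=> Ax; apply: filterS (open_nbhs_nbhs (conj oA Ax)) => z /fg.
move=> [df Cf]; split.
  by move=> x Ax; have [] := near_eq_diff (fgx x Ax) (df x Ax).
move=> v; apply: IH (Cf v) => x Ax.
by have [_ ->] := near_eq_diff (fgx x Ax) (df x Ax).
Qed.

Lemma CkW k A f : Ck k.+1 A f -> Ck k A f.
Proof.
elim: k f => [|k IH] f [df Cf].
  by move=> x Ax; exact/differentiable_continuous/df.
by split=> // v; exact: IH.
Qed.

Lemma Ck_cst k A (a : R) : Ck k A (cst a : V -> R).
Proof.
elim: k a => [|k IH] a; first by move=> x _; exact: cst_continuous.
split=> [x _|v]; first exact: differentiable_cst.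
have -> : (fun x => 'd (cst a : V -> R) x v) = cst 0 by apply/funext => x; rewrite diff_cst.
exact: IH.
Qed.

Lemma CkD k A f g : open A -> Ck k A f -> Ck k A g -> Ck k A (f + g).
Proof.
move=> oA; elim: k f g => [|k IH] f g /=.
  by move=> cf cg x Ax; apply: continuousD; [exact: cf|exact: cg].
move=> [df Cf] [dg Cg]; split=> [x Ax|v].
  by apply: differentiableD; [exact: df|exact: dg].
apply: (eq_Ck oA _ (IH _ _ (Cf v) (Cg v))) => x Ax.
by rewrite diffD//; [exact: df|exact: dg].
Qed.

Lemma CkM k A f g : open A -> Ck k A f -> Ck k A g -> Ck k A (f * g).
Proof.
move=> oA; elim: k f g => [|k IH] f g.
  by move=> cf cg x Ax; apply: continuousM; [exact: cf|exact: cg].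
move=> Cf1 Cg1; have [df Cf] := Cf1; have [dg Cg] := Cg1; split=> [x Ax|v].
  by apply: differentiableM; [exact: df|exact: dg].
have := CkD oA (IH _ _ (CkW Cf1) (Cg v)) (IH _ _ (CkW Cg1) (Cf v)).
apply: (eq_Ck oA) => x Ax.
by rewrite diffM//; [exact: df|exact: dg].
Qed.

Lemma smooth_on_cst A (a : R) : smooth_on A (cst a : V -> R).
Proof. by move=> k; exact: Ck_cst. Qed.

Lemma smooth_onD A f g : open A ->
  smooth_on A f -> smooth_on A g -> smooth_on A (f + g).
Proof. by move=> oA Cf Cg k; exact: CkD. Qed.

Lemma smooth_onM A f g : open A ->
  smooth_on A f -> smooth_on A g -> smooth_on A (f * g).
Proof. by move=> oA Cf Cg k; exact: CkM. Qed.

End CkTheory.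

Lemma open_setX (V W : topologicalType) (A : set V) (B : set W) :
  open A -> open B -> open (A `*` B).
Proof.
move=> oA oB; rewrite openE => -[x y] [/= Ax By]; exists (A, B) => //=.
by split; apply: open_nbhs_nbhs.
Qed.

Lemma open_nonzero (R : realType) (V : normedModType R) :
  open (~` [set 0] : set V).
Proof.
apply: closed_openC; apply: accessible_closed_set1.
by apply: hausdorff_accessible; exact: norm_hausdorff.
Qed.

Lemma Ck_fst (R : realType) (V W : normedModType R) k (A : set V) (B : set W)
  (f : V -> R) : open A -> open B -> Ck k A f -> Ck k (A `*` B) (fun p => f p.1).
Proof.
move=> oA oB; have oAB : open (A `*` B).
  exact: open_setX.
elim: k f => [|k IH] f.
  move=> cf p [Ap _]; apply: (@continuous_comp _ _ _ fst f); first exact: cvg_fst.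
  exact: cf.
move=> [df Cf]; have dfst (p : V * W) : differentiable fst p.
  by apply: linear_differentiable => x; exact: cvg_fst.
split=> [p [Ap _]|v].
  apply: (@differentiable_comp _ _ _ _ fst f) => //; exact: df.
apply: (eq_Ck oAB _ (IH _ (Cf v.1))) => p [Ap _].
have dE : 'd fst p = fst :> (V * W -> V).
  by apply: diff_lin => x; exact: cvg_fst.
have := @diff_comp _ _ _ _ fst f p (dfst p) (df _ Ap).
by move=> /(congr1 (fun F => F v)) /= ->; rewrite dE.
Qed.

Record chart (R : realType) (n : nat) (T : topologicalType) := Chart {
  cdom : set T;
  cmap : T -> 'rV[R]_n;
  cinv : 'rV[R]_n -> T;
  cdom_open : open cdom;
  cimg_open : open (cmap @` cdom);
  cmapK : forall x, cdom x -> cinv (cmap x) = x;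
  cmap_continuous : forall x, cdom x -> {for x, continuous cmap};
  cinv_continuous : forall u, (cmap @` cdom) u -> {for u, continuous cinv} }.

Definition cimg R n T (c : chart R n T) : set 'rV[R]_n := cmap c @` cdom c.

(* As in Kobayashi-Nomizu, no countability axiom is imposed; second countable
   or paracompact manifolds are particular cases. *)
Record manifold (R : realType) (n : nat) := Manifold {
  mpoint :> topologicalType;
  mindex : Type;
  mchart : mindex -> chart R n mpoint;
  mhausdorff : hausdorff_space mpoint;
  mcover : forall x : mpoint, exists i, cdom (mchart i) x;
  mcompat : forall i j, smooth_on
    (cmap (mchart i) @` (cdom (mchart i) `&` cdom (mchart j)))
    (cmap (mchart j) \o cinv (mchart i)) }.

Section SmoothFunctions.
Context {R : realType} {n : nat}.
Variable M : manifold R n.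

Definition smooth_pred : {pred M -> R} := fun f =>
  `[< forall i, smooth_on (cimg (mchart i)) (f \o cinv (mchart i)) >].

Fact smooth_subring : GRing.subring_closed smooth_pred.
Proof.
split=> [|f g /asboolP Hf /asboolP Hg|f g /asboolP Hf /asboolP Hg].
- by apply/asboolP => i; exact: smooth_on_cst.
- apply/asboolP => i.
  have -> : (f - g) \o cinv (mchart i) = (f \o cinv (mchart i)) +
      (cst (-1) * (g \o cinv (mchart i))).
    by apply/funext => u; rewrite !fctE /= mulN1r.
  apply: smooth_onD => //; first exact: cimg_open.
  by apply: smooth_onM => //; [exact: cimg_open|exact: smooth_on_cst].
- apply/asboolP => i.
  by apply: (@smooth_onM _ _ _ (f \o _) (g \o _)) => //; exact: cimg_open.
Qed.

Fact smooth_scale : GRing.scaler_closed smooth_pred.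
Proof.
move=> a f /asboolP Hf; apply/asboolP => i.
apply: (@smooth_onM _ _ _ (cst a) (f \o _)) => //; first exact: cimg_open.
exact: smooth_on_cst.
Qed.

HB.instance Definition _ :=
  GRing.isSubringClosed.Build (M -> R) smooth_pred smooth_subring.
HB.instance Definition _ :=
  GRing.isScaleClosed.Build R (M -> R) smooth_pred smooth_scale.

Definition Cinf := {f : M -> R | f \in smooth_pred}.
HB.instance Definition _ := Choice.on Cinf.
HB.instance Definition _ := SubChoice.on Cinf.
HB.instance Definition _ :=
  GRing.SubChoice_isSubComPzRing.Build _ _ Cinf smooth_subring.
HB.instance Definition _ := [SubZmodule_isSubLmodule of Cinf by <:].

Definition Cinf_fun (f : Cinf) : M -> R := val f.
Coercion Cinf_fun : Cinf >-> Funclass.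

(* TM, with tangent vectors as derivations of C^oo(M) at a point. *)
Record tangent := Tangent {
  tbase : M;
  tact :> Cinf -> R;
  tact_scalar : scalar tact;
  tact_leibniz : forall f g : Cinf,
    tact (f * g) = tact f * g tbase + f tbase * tact g }.


Definition has_coords (i : mindex M) (v : tangent) (x y : 'rV[R]_n) : Prop :=
  [/\ cimg (mchart i) x, tbase v = cinv (mchart i) x &
      forall f : Cinf, v f = 'd (f \o cinv (mchart i)) x y].

(* The slit tangent bundle: nonzero tangent vectors. *)
Definition slit_pred : {pred tangent} := fun v => `[< exists f, v f != 0 >].
Definition slit := {v : tangent | v \in slit_pred}.

Definition slit_dom (i : mindex M) : set ('rV[R]_n * 'rV[R]_n) :=
  cimg (mchart i) `*` ~` [set 0].

Lemma slit_dom_open i : open (slit_dom i).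
Proof. by apply: open_setX; [exact: cimg_open|exact: open_nonzero]. Qed.

(* F is smooth iff it has a smooth expression in each natural chart of TM. *)
Definition slit_smooth_pred : {pred slit -> R} := fun F =>
  `[< forall i, exists2 Fi : 'rV[R]_n * 'rV[R]_n -> R,
        smooth_on (slit_dom i) Fi &
        forall (v : slit) x y, has_coords i (val v) x y -> F v = Fi (x, y) >].

Fact slit_smooth_subring : GRing.subring_closed slit_smooth_pred.
Proof.
split=> [|F G /asboolP HF /asboolP HG|F G /asboolP HF /asboolP HG];
  apply/asboolP => i.
- by exists (cst 1) => //; exact: smooth_on_cst.
- have [[Fi sF FE] [Gi sG GE]] := (HF i, HG i).
  exists (Fi + cst (-1) * Gi).
    apply: smooth_onD => //; first exact: slit_dom_open.
    by apply: smooth_onM => //; [exact: slit_dom_open|exact: smooth_on_cst].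
  by move=> v x y vxy; rewrite !fctE /= mulN1r (FE v x y) // (GE v x y).
- have [[Fi sF FE] [Gi sG GE]] := (HF i, HG i).
  exists (Fi * Gi); first by apply: smooth_onM => //; exact: slit_dom_open.
  by move=> v x y vxy; rewrite !fctE /= (FE v x y) // (GE v x y).
Qed.

Fact slit_smooth_scale : GRing.scaler_closed slit_smooth_pred.
Proof.
move=> a F /asboolP HF; apply/asboolP => i; have [Fi sF FE] := HF i.
exists (cst a * Fi).
  by apply: smooth_onM => //; [exact: slit_dom_open|exact: smooth_on_cst].
by move=> v x y vxy; rewrite !fctE /= (FE v x y).
Qed.

HB.instance Definition _ :=
  GRing.isSubringClosed.Build (slit -> R) slit_smooth_pred slit_smooth_subring.
HB.instance Definition _ :=
  GRing.isScaleClosed.Build R (slit -> R) slit_smooth_pred slit_smooth_scale.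

Definition Cslit := {F : slit -> R | F \in slit_smooth_pred}.
HB.instance Definition _ := Choice.on Cslit.
HB.instance Definition _ := SubChoice.on Cslit.
HB.instance Definition _ :=
  GRing.SubChoice_isSubComPzRing.Build _ _ Cslit slit_smooth_subring.
HB.instance Definition _ := [SubZmodule_isSubLmodule of Cslit by <:].

Definition Cslit_fun (F : Cslit) : slit -> R := val F.
Coercion Cslit_fun : Cslit >-> Funclass.

Fact pullback_smooth (f : Cinf) :
  (fun v : slit => f (tbase (val v))) \in slit_smooth_pred.
Proof.
apply/asboolP => i; exists (fun p => f (cinv (mchart i) p.1)).
  have /asboolP/(_ i) sf : smooth_pred (val f) := valP f.
  move=> k; apply: (Ck_fst _ _ (sf k)); first exact: cimg_open.
  exact: open_nonzero.
by move=> v x y [_ -> _].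
Qed.

Definition pullback (f : Cinf) : Cslit :=
  exist (fun F => F \in slit_smooth_pred) _ (pullback_smooth f).

(* Vector fields on the slit tangent bundle are the derivations of its smooth
   functions; the codomain Cslit^o makes them a module over Cslit. *)
Definition derivation (X : Cslit -> Cslit) : Prop :=
  (forall (a : R) F G, X (a *: F + G) = a *: X F + X G) /\
  (forall F G, X (F * G) = X F * G + F * X G).

Definition derivation_pred : {pred Cslit -> Cslit^o} := fun X => `[< derivation X >].

Fact derivation_submod : GRing.submod_closed derivation_pred.
Proof.
split=> [|A X Y /asboolP[lX dX] /asboolP[lY dY]]; apply/asboolP.
  split=> [a F G|F G].
    by change (0 = a *: 0 + 0 :> Cslit); rewrite scaler0 addr0.
  by change (0 = 0 * G + F * 0 :> Cslit); rewrite mul0r mulr0 addr0.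
split=> [a F G|F G].
  change (A * X (a *: F + G) + Y (a *: F + G) =
          a *: (A * X F + Y F) + (A * X G + Y G) :> Cslit).
  rewrite lX lY mulrDr scalerDr addrACA; congr (_ + _ + _).
  apply: val_inj; apply/funext => v; exact: mulrCA.
change (A * X (F * G) + Y (F * G) =
        (A * X F + Y F) * G + F * (A * X G + Y G) :> Cslit).
rewrite dX dY !mulrDl !mulrDr !mulrA (mulrC F A) addrACA.
by rewrite -!addrA.
Qed.

HB.instance Definition _ :=
  GRing.isSubmodClosed.Build Cslit (Cslit -> Cslit^o) derivation_pred
    derivation_submod.

Definition vfield := {X : Cslit -> Cslit^o | X \in derivation_pred}.
HB.instance Definition _ := Choice.on vfield.
HB.instance Definition _ := SubChoice.on vfield.
HB.instance Definition _ := [SubChoice_isSubLmodule of vfield by <:].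

Definition vfield_fun (X : vfield) : Cslit -> Cslit := val X.
Coercion vfield_fun : vfield >-> Funclass.

Lemma vfieldP (X : vfield) : derivation X.
Proof. by apply/asboolP; exact: (valP X). Qed.

Lemma vfieldD (X : vfield) F G : X (F + G) = X F + X G.
Proof. by have [lX _] := vfieldP X; have := lX 1 F G; rewrite !scale1r. Qed.

Fact lie_derivation (X Y : vfield) :
  (fun F => X (Y F) - Y (X F)) \in derivation_pred.
Proof.
have [[lX dX] [lY dY]] := (vfieldP X, vfieldP Y); apply/asboolP.
split=> [a F G|F G].
  by rewrite lX lY lX lY opprD addrACA scalerBr.
by rewrite dX dY !vfieldD !dX !dY; ring.
Qed.

Definition lie (X Y : vfield) : vfield :=
  exist (fun Z => Z \in derivation_pred) _ (lie_derivation X Y).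

(* The image of X at v under the differential of the projection to M. *)
Fact pushforward_scalar (X : vfield) (v : slit) :
  scalar (fun f : Cinf => X (pullback f) v).
Proof.
move=> a f g; have [lX _] := vfieldP X.
have -> : pullback (a *: f + g) = a *: pullback f + pullback g.
  by apply: val_inj; apply/funext.
by rewrite lX.
Qed.

Fact pushforward_leibniz (X : vfield) (v : slit) (f g : Cinf) :
  X (pullback (f * g)) v =
  X (pullback f) v * g (tbase (val v)) + f (tbase (val v)) * X (pullback g) v.
Proof.
have [_ dX] := vfieldP X.
have -> : pullback (f * g) = pullback f * pullback g.
  by apply: val_inj; apply/funext.
by rewrite dX.
Qed.

Definition pushforward (X : vfield) (v : slit) : tangent :=
  Tangent (pushforward_scalar X v) (pushforward_leibniz X v).

(* The affine line t |-> v + t w in the tangent space containing v and w. *)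
Fact tline_scalar (v w : tangent) (t : R) :
  scalar (fun f : Cinf => v f + t * w f).
Proof.
move=> a f g; rewrite !tact_scalar !mulrDr addrACA; congr (_ + _ + _).
by rewrite mulrCA.
Qed.

Fact tline_leibniz (v w : tangent) (e : tbase w = tbase v) (t : R) (f g : Cinf) :
  v (f * g) + t * w (f * g) =
  (v f + t * w f) * g (tbase v) + f (tbase v) * (v g + t * w g).
Proof.
rewrite !tact_leibniz e !mulrDl !mulrDr addrACA !mulrA.
by rewrite [t * f _]mulrC.
Qed.

Definition tline (v w : tangent) (e : tbase w = tbase v) (t : R) : tangent :=
  Tangent (tline_scalar v w t) (tline_leibniz e t).

Definition ext0 (F : slit -> R) (v : tangent) : R :=
  oapp F 0 (insub v : option slit).

(* J X at v is the vertical lift to v of the projection of X_v to M; in natural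
   coordinates J(d/dx^i) = d/dy^i and J(d/dy^i) = 0. *)
Definition vertical_endomorphism (J : {linear vfield -> vfield}) : Prop :=
  forall (X : vfield) (F : Cslit) (v : slit),
    is_derive (0 : R) 1
      (fun t => ext0 F (tline (erefl : tbase (pushforward X v) = tbase (val v)) t))
      ((J X : vfield) F v).

(* C at v is the vertical lift of v to v; in natural coordinates y^i d/dy^i. *)
Definition liouville (C : vfield) : Prop :=
  forall (F : Cslit) (v : slit),
    is_derive (0 : R) 1
      (fun t => ext0 F (tline (erefl : tbase (val v) = tbase (val v)) t))
      (C F v).

Definition vertical (X : vfield) : Prop := forall f : Cinf, X (pullback f) = 0.

Definition half : Cslit := (2^-1 : R) *: (1 : Cslit).

(* Froelicher-Nijenhuis brackets: [L, X] for a vector 1-form L and a vector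
   field X, and [K, L] for vector 1-forms K and L. *)
Definition fn10 (L : vfield -> vfield) (X Y : vfield) : vfield :=
  - (lie X (L Y) - L (lie X Y)).

Definition fn11 (K L : vfield -> vfield) (X Y : vfield) : vfield :=
  lie (K X) (L Y) + lie (L X) (K Y) + K (L (lie X Y)) + L (K (lie X Y))
  - K (lie (L X) Y) - K (lie X (L Y)) - L (lie (K X) Y) - L (lie X (K Y)).

Definition lie_form (X : vfield) (b : vfield -> vfield -> Cslit)
    (Y Z : vfield) : Cslit :=
  X (b Y Z) - b (lie X Y) Z - b Y (lie X Z).

Definition ext_deriv (alpha : vfield -> Cslit) (X Y : vfield) : Cslit :=
  X (alpha Y) - Y (alpha X) - alpha (lie X Y).

Section FinslerObjects.
Variables (J : vfield -> vfield) (E : Cslit).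

Definition dJ (X : vfield) : Cslit := J X E.
Definition Omega : vfield -> vfield -> Cslit := ext_deriv dJ.

(* Pointwise non-degeneracy of Omega. *)
Definition maximal_rank : Prop :=
  forall (v : slit) (X : vfield), (forall Y : vfield, Omega X Y v = 0) ->
    forall F : Cslit, X F v = 0.

Definition canonical_spray (S : vfield) : Prop :=
  forall X : vfield, Omega S X = - X E.

Variable S : vfield.

Definition barthel : vfield -> vfield := fn10 J S.
Definition hproj (X : vfield) : vfield := half *: (X + barthel X).
Definition vproj (X : vfield) : vfield := half *: (X - barthel X).
Definition barthel_curvature (X Y : vfield) : vfield :=
  - (half *: fn11 hproj hproj X Y).

Definition almost_complex (F : vfield -> vfield) : Prop :=
  (forall X, F (J X) = hproj X) /\ (forall X, F (hproj X) = - J X).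

Variable F : vfield -> vfield.

Definition metric (X Y : vfield) : Cslit := Omega X (F Y).
Definition Jmetric (X Y : vfield) : Cslit := metric (J X) (J Y).

Definition sym_vertical_tensor (T : vfield -> vfield -> vfield) : Prop :=
  [/\ forall Y, linear (T ^~ Y), forall X, linear (T X),
      forall X Y, T X Y = T Y X & forall X Y, vertical (T X Y)].

Definition first_cartan_tensor (T : vfield -> vfield -> vfield) : Prop :=
  sym_vertical_tensor T /\
  forall X Y Z, Omega (T X Y) Z = 2^-1 *: lie_form (J X) Jmetric Y Z.

Definition second_cartan_tensor (T : vfield -> vfield -> vfield) : Prop :=
  sym_vertical_tensor T /\
  forall X Y Z,
    Omega (T X Y) Z = 2^-1 *: lie_form (hproj X) metric (J Y) (J Z).

End FinslerObjects.

(* energy_slit is the restriction of the energy to the slit bundle. *)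
Record finsler_energy (J : vfield -> vfield) (C : vfield) := FinslerEnergy {
  energy : tangent -> R;
  energy_slit :> Cslit;
  energy_slitE : forall v : slit, energy_slit v = energy (val v);
  energy_gt0 : forall v : slit, 0 < energy (val v);
  energy0 : forall v : tangent, (forall f : Cinf, v f = 0) -> energy v = 0;
  energy_C1 : forall i, exists2 Ei : 'rV[R]_n * 'rV[R]_n -> R,
    Ck 1 (cimg (mchart i) `*` setT) Ei &
    forall v x y, has_coords i v x y -> energy v = Ei (x, y);
  energy_homogeneous : C energy_slit = (2 : R) *: energy_slit;
  energy_rank : maximal_rank J energy_slit }.

Record connection := Connection {
  conn :> vfield -> vfield -> vfield;
  conn_linear : forall Y, linear (conn ^~ Y);
  conn_additive : forall X Y Z, conn X (Y + Z) = conn X Y + conn X Z;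
  conn_leibniz : forall X (F : Cslit) Y,
    conn X (F *: Y) = X F *: Y + F *: conn X Y }.

Definition parallel_end (D : connection) (L : vfield -> vfield) : Prop :=
  forall X Y, D X (L Y) = L (D X Y).

Definition torsion (D : connection) (X Y : vfield) : vfield :=
  D X Y - D Y X - lie X Y.

Definition curvature (D : connection) (X Y Z : vfield) : vfield :=
  D X (D Y Z) - D Y (D X Z) - D (lie X Y) Z.

Definition cov_tensor (D : connection) (T : vfield -> vfield -> vfield)
    (W X Z : vfield) : vfield :=
  D W (T X Z) - T (D W X) Z - T X (D W Z).

Section Connections.
Variables (J : vfield -> vfield) (S : vfield).
Local Notation h := (hproj J S).
Local Notation v := (vproj J S).

Definition h_curvature (D : connection) (X Y Z : vfield) : vfield :=
  curvature D (h X) (h Y) (J Z).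
Definition hv_curvature (D : connection) (X Y Z : vfield) : vfield :=
  curvature D (h X) (J Y) (J Z).
Definition v_curvature (D : connection) (X Y Z : vfield) : vfield :=
  curvature D (J X) (J Y) (J Z).

Definition berwald (F : vfield -> vfield) (D : connection) : Prop :=
  [/\ forall X Y, D (J X) (J Y) = J (lie (J X) Y),
      forall X Y, D (h X) (J Y) = v (lie (h X) (J Y)) &
      parallel_end D F].

(* T and T' are the two Cartan tensors and D0 is the Berwald connection. *)
Definition cartan (F : vfield -> vfield) (T T' : vfield -> vfield -> vfield)
    (D0 D : connection) : Prop :=
  [/\ forall X Y, D (J X) (J Y) = D0 (J X) (J Y) + T X Y,
      forall X Y, D (h X) (J Y) = D0 (h X) (J Y) + T' X Y &
      parallel_end D F].

Definition chern (C : vfield) (g : vfield -> vfield -> Cslit)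
    (D : connection) : Prop :=
  [/\ parallel_end D J /\ (forall X, D X C = v X),
      parallel_end D (barthel J S),
      forall X Y, D (J X) (J Y) = J (lie (J X) Y),
      forall X Y Z, h X (g Y Z) = g (D (h X) Y) Z + g Y (D (h X) Z) &
      forall X Y, J (torsion D (h X) (h Y)) = 0].

End Connections.

End SmoothFunctions.

(* Main.v *)
From HB Require Import structures.
Require Import Defs.
From mathcomp Require Import all_boot all_order all_algebra.
From mathcomp Require Import all_classical all_reals all_analysis.
From mathcomp Require Import ring.

(** Everything happens in the Lie algebra of derivations of the smooth functions
    on the slit tangent bundle, and the only analytic input is that the
    differential of a function f on M is a smooth function on tangent vectors, on
    which J X acts as X acts on the pullback of f ([J_fibre_differential]).

    The existence of a linear F with FJ = h makes the kernel of J equal to its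
    image: every vertical field V is J(- [S, V]) ([kerJ_imJ]). With the previous
    fact this yields [J, J] = 0 ([nijenhuisJ]). Taking the Lie derivative of
    [J, J] = 0 along S shows that the Barthel connection has no torsion
    ([barthel_torsion_free]); taking the Lie derivative of Omega along S shows that
    horizontal fields are isotropic for Omega ([Omega_hh]), so that horizontal and
    vertical fields are orthogonal for the metric.

    The Chern connection is characterized by being horizontally metric and
    horizontally without torsion. A Koszul argument turns this into the explicit
    formula D_hX JY = v[hX, JY] + C'(X, Y) ([chern_horizontal]). In horizontal
    directions the Chern connection is thus the Cartan connection, and it is the
    Berwald connection plus C'; in vertical directions it is the Berwald
    connection, that is, the Cartan connection minus C.

    The curvatures are then compared by splitting the bracket of the two directions
    into its horizontal and vertical parts. For R only the vertical part of
    [hX, hY], which is minus the Barthel curvature, sees the difference C between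
    the connections. For P the terms in C' assemble into its covariant derivative
    because C' is semibasic. For Q the Jacobi identity gives 0. *)

Local Open Scope ring_scope.

(** * Fibrewise linear functions on the tangent bundle *)

Section FibreDifferential.
Set Implicit Arguments.
Unset Strict Implicit.
Import GRing.Theory Num.Theory numFieldNormedType.Exports.
Local Open Scope classical_set_scope.

Lemma Ck_linear (R : realType) (V : normedModType R) k (A : set V)
    (l : {linear V -> R}) : continuous l -> Ck k A l.
Proof.
move=> cl; case: k => [|k]; first by move=> x _; exact: cl.
split=> [x _|v]; first exact: linear_differentiable.
have -> : (fun x => 'd l x v) = cst (l v).
  by apply/funext => x; rewrite diff_lin.
exact: Ck_cst.
Qed.

Lemma Ck_sum (R : realType) (V : normedModType R) k (A : set V) (m : nat)
    (f : 'I_m -> V -> R) :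
  open A -> (forall j, Ck k A (f j)) -> Ck k A (fun x => \sum_j f j x).
Proof.
move=> oA Cf.
have -> : (fun x => \sum_j f j x) = \sum_j f j by rewrite fct_sumE.
by apply: big_ind => [|g h|j _]; [exact: Ck_cst | exact: CkD | exact: Cf].
Qed.

Lemma is_derive_unique (R : realType) (V W : normedModType R) (f : V -> W)
  (x v : V) (d d' : W) : is_derive x v f d -> is_derive x v f d' -> d = d'.
Proof. by move=> [_ <-] [_ <-]. Qed.

Variables (R : realType) (n : nat) (M : manifold R n).

(** The smoothness of the fibre coordinate expression of a differential: 'd f x y
    is the sum of the y_j 'd f x e_j, each factor of which is smooth by definition. *)
Lemma smooth_on_diff (A B : set 'rV[R]_n) (f : 'rV[R]_n -> R) :
  open A -> open B -> smooth_on A f ->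
  smooth_on (A `*` B) (fun p : 'rV[R]_n * 'rV[R]_n => 'd f (p.1) p.2).
Proof.
move=> oA oB sf k.
have -> : (fun p : 'rV[R]_n * 'rV[R]_n => 'd f (p.1) p.2) =
    (fun p => \sum_j p.2 ord0 j * 'd f (p.1) (delta_mx ord0 j)).
  apply/funext => p; rewrite [in LHS](row_sum_delta p.2) linear_sum.
  by apply: eq_bigr => j _; rewrite linearZ.
have oAB : open (A `*` B) by exact: open_setX.
apply: Ck_sum => // j.
pose y (p : 'rV[R]_n * 'rV[R]_n) : R := p.2 ord0 j.
pose df (p : 'rV[R]_n * 'rV[R]_n) : R := 'd f (p.1) (delta_mx ord0 j).
rewrite -[X in Ck _ _ X]/(y * df); apply: CkM => //.
  have ly : linear y by move=> a p q; rewrite /y /= !mxE.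
  pose L : {linear _ -> _} :=
    HB.pack y (GRing.isLinear.Build R _ R *%R y ly).
  apply: (@Ck_linear _ _ k _ L) => p.
  apply: (@continuous_comp _ _ _ snd (fun y : 'rV[R]_n => y ord0 j)).
    exact: cvg_snd.
  exact: coord_continuous.
apply: (@Ck_fst _ _ _ k A B (fun x => 'd f x (delta_mx ord0 j))) => //.
by have [_ Cdf] := sf k.+1; exact: Cdf.
Qed.

Fact fibre_differential_smooth (f : Cinf M) :
  (fun v : slit M => val v f) \in @slit_smooth_pred R n M.
Proof.
apply/asboolP => i.
exists (fun p : 'rV[R]_n * 'rV[R]_n =>
  'd (f \o cinv (mchart i)) (p.1) p.2); last first.
  by move=> v x y [_ _].
have /asboolP/(_ i) sf : smooth_pred (val f) := valP f.
by apply: smooth_on_diff => //; [exact: cimg_open | exact: open_nonzero].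
Qed.

(** The differential of f, seen as a function on tangent vectors. These functions
    take over the role of the fibre coordinates y^i, as the pullbacks take over that
    of the x^i. *)
Definition fibre_differential (f : Cinf M) : Cslit M :=
  exist (fun F => F \in @slit_smooth_pred R n M) _ (fibre_differential_smooth f).

Lemma tangent_eq (u w : tangent M) : tbase u = tbase w -> u =1 w -> u = w.
Proof.
case: u w => [p u lu du] [q w lw dw] /= pq /funext uw.
by subst q w; congr Tangent; exact: Prop_irrelevance.
Qed.

(** This includes the zero vectors u, where ext0 takes its default value 0: by
    definition they are the tangent vectors that vanish on all functions. *)
Lemma ext0_fibre_differential (f : Cinf M) (u : tangent M) :
  ext0 (fibre_differential f) u = u f.
Proof.
rewrite /ext0; case: insubP => [v _ <- //|/= /asboolPn u0].
by apply/esym/eqP/negPn/negP => uf; apply: u0; exists f.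
Qed.

Lemma ext0_pullback (f : Cinf M) (u : tangent M) :
  u \in @slit_pred R n M -> ext0 (pullback f) u = f (tbase u).
Proof. by move=> us; rewrite /ext0 insubT. Qed.

(** A line through a nonzero tangent vector v leaves the slit bundle only away from
    v: a function f with v f != 0 still detects the nearby points of the line. *)
Lemma tline_slit (v : slit M) (w : tangent M) (e : tbase w = tbase (val v)) :
  \forall t \near (0 : R), tline e t \in @slit_pred R n M.
Proof.
have /asboolP[f vf] := valP v.
have ct : (fun t : R => val v f + t * w f) @ (0 : R) --> val v f + 0 * w f.
  by apply: cvgD; [exact: cvg_cst | apply: cvgM; [exact: cvg_id | exact: cvg_cst]].
rewrite mul0r addr0 in ct.
have nz : \forall t \near (0 : R), val v f + t * w f != 0 by exact: cvgr_neq0 ct vf.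
by apply: filterS nz => t ht; apply/asboolP; exists f.
Qed.

Variable J : {linear vfield M -> vfield M}.
Hypothesis hJ : vertical_endomorphism J.

Lemma vertical_imJ (X : vfield M) : vertical (J X).
Proof.
move=> f; apply/val_inj/funext => v.
have fE : \forall t \near (0 : R),
    ext0 (pullback f) (tline (erefl : tbase (Defs.pushforward X v) = tbase (val v)) t) =
    cst (f (tbase (val v))) t.
  by apply: filterS (@tline_slit v (Defs.pushforward X v) erefl) => t /ext0_pullback ->.
exact: is_derive_unique (near_eq_is_derive fE (hJ _ _ _)) (is_derive_cst _ _ _).
Qed.

(** The differential of f is affine along a line in a fibre, and its slope is the
    value of the direction on f. *)
Lemma J_fibre_differential (X : vfield M) (f : Cinf M) :
  (J X : vfield M) (fibre_differential f) = X (pullback f).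
Proof.
apply/val_inj/funext => v.
apply: (is_derive_unique (hJ X (fibre_differential f) v)).
under eq_fun do rewrite ext0_fibre_differential /=.
by apply: is_derive_eq; rewrite scaler0 !add0r mul1r; exact: mulr1.
Qed.

(** The line that defines J X is constant when X projects to 0. *)
Lemma J_vertical (X : vfield M) : vertical X -> J X = 0.
Proof.
move=> vX; apply/val_inj/funext => G; apply/val_inj/funext => v.
apply: (is_derive_unique (hJ X G v)).
under eq_fun => t.
  rewrite (_ : tline _ t = val v); first over.
  by apply: tangent_eq => // f /=; rewrite vX mulr0 addr0.
exact: is_derive_cst.
Qed.

End FibreDifferential.

(** * Vector fields as derivations *)

Section VectorFields.
Set Implicit Arguments.
Unset Strict Implicit.
Import GRing.Theory Num.Theory.
Variables (R : realType) (n : nat) (M : manifold R n).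
Implicit Types (X Y Z W : vfield M) (F G : Cslit M).

Lemma vfield_ext X Y : (forall G, X G = Y G) -> X = Y.
Proof. by move=> XY; apply/val_inj/funext => G; exact: XY. Qed.

Lemma vfield0E G : (0 : vfield M) G = 0. Proof. by []. Qed.
Lemma vfieldDE X Y G : vfield_fun (X + Y) G = X G + Y G. Proof. by []. Qed.
Lemma vfieldNE X G : vfield_fun (- X) G = - X G. Proof. by []. Qed.
Lemma lieE X Y G : lie X Y G = X (Y G) - Y (X G). Proof. by []. Qed.

Lemma vfield_0 X : X 0 = 0.
Proof. by apply: (addrI (X 0)); rewrite -vfieldD !addr0. Qed.

Lemma vfieldN X G : X (- G) = - X G.
Proof. by apply/eqP; rewrite -addr_eq0 -vfieldD addNr vfield_0. Qed.

Definition vfieldE := (vfield0E, vfieldDE, vfieldNE, lieE).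
Definition vfield_derivE := (vfield_0, @vfieldD, vfieldN).

Lemma vfield_halfK X : Defs.half M *: (X + X) = X.
Proof.
rewrite scalerDr -scalerDl /Defs.half -[2^-1]mul1r -scalerDl -splitr.
by rewrite !scale1r.
Qed.

Lemma vfield_double_inj X Y : X + X = Y + Y -> X = Y.
Proof. by move=> /(congr1 ( *:%R (Defs.half M))); rewrite !vfield_halfK. Qed.

Lemma Cslit_double_inj F G : F + F = G + G -> F = G.
Proof.
move=> /(congr1 ( *:%R (2^-1 : R))); rewrite !scalerDr -!scalerDl.
by rewrite -[2^-1]mul1r -splitr !scale1r.
Qed.

(** A linear combination step: it feeds the known equation a = b into a goal that
    follows from it by ring identities alone. *)
Lemma eq_of_subr_eq {V : zmodType} {a b c d : V} :
  a = b -> c - d = a - b -> c = d.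
Proof.
by move=> ->; rewrite subrr => /eqP; rewrite subr_eq0 => /eqP.
Qed.

End VectorFields.

(** Identities between vector fields are checked on functions: after expansion of
    sums, brackets and the derivation rules, they are identities in a commutative
    ring, with the iterated derivatives as atoms. *)
Ltac fring := do ?rewrite vfieldE; do ?rewrite vfield_derivE; ring.
Ltac vring := apply: vfield_ext => ?; fring.

Section LieBracket.
Set Implicit Arguments.
Unset Strict Implicit.
Import GRing.Theory Num.Theory.
Variables (R : realType) (n : nat) (M : manifold R n).
Implicit Types X Y Z : vfield M.

Lemma lieC X Y : lie X Y = - lie Y X. Proof. vring. Qed.
Lemma lie0l X : lie 0 X = 0. Proof. vring. Qed.
Lemma lie0r X : lie X 0 = 0. Proof. vring. Qed.
Lemma lieDl X Y Z : lie (X + Y) Z = lie X Z + lie Y Z. Proof. vring. Qed.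
Lemma lieDr X Y Z : lie X (Y + Z) = lie X Y + lie X Z. Proof. vring. Qed.
Lemma lieNl X Y : lie (- X) Y = - lie X Y. Proof. vring. Qed.
Lemma lieNr X Y : lie X (- Y) = - lie X Y. Proof. vring. Qed.
Lemma jacobi X Y Z : lie X (lie Y Z) = lie (lie X Y) Z + lie Y (lie X Z).
Proof. vring. Qed.

Lemma vertical_lie X Y : vertical X -> vertical Y -> vertical (lie X Y).
Proof. by move=> vX vY f; rewrite lieE vX vY !vfield_0 subrr. Qed.

Lemma lie_form0 (b : vfield M -> vfield M -> Cslit M) Y Z :
  b 0 Z = 0 -> b Y 0 = 0 -> lie_form 0 b Y Z = 0.
Proof. by move=> b0 b0'; rewrite /lie_form !lie0l b0 b0'; fring. Qed.

Lemma conn_addl (N : connection M) X Y Z : N (X + Y) Z = N X Z + N Y Z.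
Proof. by have := conn_linear N Z 1 X Y; rewrite !scale1r. Qed.

End LieBracket.

(** * The Barthel connection *)

Section FinslerSpace.
Set Implicit Arguments.
Unset Strict Implicit.
Import GRing.Theory Num.Theory.
Variables (R : realType) (n : nat) (M : manifold R n).
Variables (J F : {linear vfield M -> vfield M}) (S : vfield M).
Hypotheses (hJ : vertical_endomorphism J) (hF : almost_complex J S F).
Implicit Types X Y Z U V W : vfield M.
Local Notation h := (hproj J S).
Local Notation v := (vproj J S).
Local Notation G := (barthel J S).

Lemma JJ X : J (J X) = 0.
Proof. exact/(J_vertical hJ)/vertical_imJ. Qed.

(** The projector h is tensorial because it factors through J; this makes its
    linearity and the identities hJ = 0 and Jh = J formal. *)
Lemma hprojE X : h X = F (J X). Proof. by case: hF => ->. Qed.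

Lemma Fh X : F (h X) = - J X. Proof. by case: hF. Qed.

Lemma hprojD X Y : h (X + Y) = h X + h Y.
Proof. by rewrite !hprojE !linearD. Qed.

Lemma hprojN X : h (- X) = - h X.
Proof. by rewrite !hprojE !linearN. Qed.

Lemma double_hproj X : h X + h X = X + G X.
Proof. by rewrite /hproj -scalerDr vfield_halfK. Qed.

Lemma hproj_plus_vproj X : h X + v X = X.
Proof.
apply: vfield_double_inj; rewrite addrACA double_hproj /vproj -scalerDr.
by rewrite vfield_halfK addrACA subrr addr0.
Qed.

Lemma vprojE X : v X = X - h X.
Proof. by rewrite -{2}(hproj_plus_vproj X) addrAC subrr add0r. Qed.

Lemma barthelE X : G X = h X + h X - X.
Proof. by rewrite double_hproj addrAC subrr add0r. Qed.

Lemma hprojJ X : h (J X) = 0.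
Proof. by rewrite hprojE JJ linear0. Qed.

Lemma barthel_lie X : G X = J (lie S X) - lie S (J X).
Proof. by rewrite /barthel /fn10 opprB. Qed.

(** This is J[S, JX] = - JX, which holds for any spray; here it is read off from
    hJ = 0. *)
Lemma J_lie_spray X : J (lie S (J X)) = - J X.
Proof.
have := barthel_lie (J X).
by rewrite JJ barthelE hprojJ addr0 sub0r lie0r subr0 => ->.
Qed.

Lemma J_barthel X : J (G X) = J X.
Proof. by rewrite barthel_lie linearB JJ sub0r J_lie_spray opprK. Qed.

Lemma J_hproj X : J (h X) = J X.
Proof. by apply: vfield_double_inj; rewrite -linearD double_hproj linearD J_barthel. Qed.

Lemma barthel_hproj X : G (h X) = h X.
Proof. by rewrite barthelE !(hprojE (h X)) J_hproj -!hprojE addrK. Qed.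

(** Exactness of J, with an explicit primitive: h X = F(J X) = 0 gives G X = - X,
    and G X = J[S, X] when J X = 0. Hence a vertical field is globally in the
    image of J, without any partition of unity. *)
Lemma kerJ_imJ X : J X = 0 -> X = J (- lie S X).
Proof.
move=> JX0; have := barthel_lie X.
rewrite barthelE hprojE JX0 linear0 lie0r subr0 addr0 sub0r => XE.
by rewrite linearN -XE opprK.
Qed.

Lemma kerJ_vertical X : J X = 0 <-> vertical X.
Proof.
split=> [/kerJ_imJ ->|]; last exact: J_vertical.
exact: vertical_imJ.
Qed.

Lemma J_vproj X : J (v X) = 0.
Proof. by rewrite vprojE linearB J_hproj subrr. Qed.

Lemma vproj_imJ X : exists U, v X = J U.
Proof. by exists (- lie S (v X)); exact/kerJ_imJ/J_vproj. Qed.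

Lemma bracket_split X Y : exists2 U, v (lie X Y) = J U & lie X Y = h (lie X Y) + J U.
Proof.
have [U UE] := vproj_imJ (lie X Y).
by exists U => //; rewrite -UE hproj_plus_vproj.
Qed.

Lemma vertical_imJP X : vertical X -> exists U, X = J U.
Proof. by move=> /kerJ_vertical/kerJ_imJ ->; eexists. Qed.

Lemma vertical_lieJJ X Y : vertical (lie (J X) (J Y)).
Proof. by apply: vertical_lie; exact: vertical_imJ. Qed.

Lemma J_lieJJ X Y : J (lie (J X) (J Y)) = 0.
Proof. exact/kerJ_vertical/vertical_lieJJ. Qed.

(** The Nijenhuis tensor of J vanishes. Its value W is vertical, hence W = J U with
    U = - [S, W], and it suffices that U kills the pullbacks. But U (pullback f) is
    W applied to the differential of f, and on such functions the definition of W
    gives 0 since J X acts on them as X acts on pullbacks. *)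
Lemma nijenhuisJ X Y : lie (J X) (J Y) = J (lie (J X) Y) + J (lie X (J Y)).
Proof.
pose W := lie (J X) (J Y) - (J (lie (J X) Y) + J (lie X (J Y))).
have JW : J W = 0 by rewrite linearB linearD /= J_lieJJ !JJ !addr0 subrr.
suff W0 : vertical (- lie S W).
  by apply/eqP; rewrite -subr_eq0 -/W (kerJ_imJ JW) (J_vertical hJ W0).
move=> f; rewrite -(J_fibre_differential hJ) -(kerJ_imJ JW) /W.
rewrite vfieldDE vfieldNE vfieldDE lieE !(J_fibre_differential hJ) !lieE.
by rewrite !(vertical_imJ hJ) !vfield_0; ring.
Qed.

Lemma lie_sprayJ X : lie S (J X) = J (lie S X) - G X.
Proof. by rewrite barthel_lie opprB addrC subrK. Qed.

(** The bracket [J, G] vanishes: apply the Lie derivative along S to [J, J] = 0. *)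
Lemma lie_barthel X Y :
  lie (G X) (J Y) + lie (J X) (G Y) =
  J (lie (G X) Y) + J (lie X (G Y)) + G (lie (J X) Y) + G (lie X (J Y)).
Proof.
move: (barthel J S) lie_sprayJ => g lSJ.
have := congr1 (lie S) (nijenhuisJ X Y).
rewrite lieDr !lSJ !(jacobi S) !lSJ !lieDl !lieDr !lieNl !lieNr.
rewrite !linearD !linearN /= !nijenhuisJ => e.
by apply: (eq_of_subr_eq (esym e)); vring.
Qed.

(** The previous identity on horizontal arguments: the Barthel connection has no
    torsion. *)
Lemma barthel_torsion_free X Y :
  J (lie (h X) (h Y)) = v (lie (h X) (J Y)) + v (lie (J X) (h Y)).
Proof.
have := lie_barthel (h X) (h Y).
rewrite !barthel_hproj !J_hproj !barthelE !vprojE => e.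
apply: vfield_double_inj; apply: (eq_of_subr_eq (esym e)).
(* As an atom, h is not unfolded by the expansion of sums. *)
by move: (hproj J S) => H; vring.
Qed.

(** The remaining terms of the bracket [h, h] amount to h[vX, vY], which is 0 because
    vertical fields are closed under the bracket. *)
Lemma barthel_curvatureE X Y :
  barthel_curvature J S X Y = - v (lie (h X) (h Y)).
Proof.
rewrite /barthel_curvature; congr (- _).
have hv0 : h (lie (v X) (v Y)) = 0.
  have [[U ->] [V ->]] := (vproj_imJ X, vproj_imJ Y).
  by rewrite hprojE J_lieJJ linear0.
have hh Z : h (h Z) = h Z by rewrite (hprojE (h Z)) J_hproj -hprojE.
rewrite -[RHS]vfield_halfK; congr (_ *: _); rewrite /fn11 !hh.
have e : h (lie X Y) + h (lie (h X) (h Y)) = h (lie (h X) Y) + h (lie X (h Y)).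
  move: hv0; rewrite !vprojE !lieDl !lieDr !lieNl !lieNr !hprojD !hprojN => e.
  apply: (eq_of_subr_eq e).
  by move: (hproj J S) => H; vring.
rewrite vprojE.
(* Each term of [h, h] occurs twice. *)
apply: (eq_of_subr_eq (congr1 (fun Z => Z + Z) e)).
by move: (hproj J S) => H; vring.
Qed.

(** * The fundamental form and the metric *)

Variable E : Cslit M.
Hypotheses (hS : canonical_spray J E S) (rankE : maximal_rank J E).
Local Notation Om := (Omega J E).
Local Notation g := (metric J E F).

Lemma OmegaE X Y :
  Om X Y = X (vfield_fun (J Y) E) - Y (vfield_fun (J X) E) - vfield_fun (J (lie X Y)) E.
Proof. by []. Qed.

Lemma OmegaDl X X' Y : Om (X + X') Y = Om X Y + Om X' Y.
Proof. by rewrite !OmegaE lieDl !(linearD J); fring. Qed.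

Lemma OmegaDr X Y Y' : Om X (Y + Y') = Om X Y + Om X Y'.
Proof. by rewrite !OmegaE lieDr !(linearD J); fring. Qed.

Lemma OmegaNl X Y : Om (- X) Y = - Om X Y.
Proof. by rewrite !OmegaE lieNl !(linearN J); fring. Qed.

Lemma OmegaNr X Y : Om X (- Y) = - Om X Y.
Proof. by rewrite !OmegaE lieNr !(linearN J); fring. Qed.

Lemma OmegaC X Y : Om X Y = - Om Y X.
Proof. by rewrite !OmegaE (lieC X Y) !(linearN J); fring. Qed.

Lemma Omega0l Y : Om 0 Y = 0.
Proof. by rewrite OmegaE lie0l (linear0 J); fring. Qed.

Lemma Omega_nondegenerate X : (forall Y, Om X Y = 0) -> X = 0.
Proof.
move=> X0; apply: vfield_ext => f; apply/val_inj/funext => u.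
by apply: rankE => Y; rewrite X0.
Qed.

(** Equivalently i_J Omega = 0: the two sides differ by the Nijenhuis tensor of J
    applied to E. *)
Lemma OmegaJC X Y : Om (J X) Y = Om (J Y) X.
Proof.
have e := congr1 (fun Z : vfield M => Z E) (nijenhuisJ X Y).
rewrite vfieldDE in e.
rewrite !OmegaE !JJ (lieC (J Y)) !(linearN J) !vfieldE.
by apply: (eq_of_subr_eq e); fring.
Qed.

Lemma OmegaJJ X Y : Om (J X) (J Y) = 0.
Proof. by rewrite OmegaE !JJ J_lieJJ; fring. Qed.

(** S preserves Omega: the Lie derivative of the exact form Omega along S is the
    differential of i_S Omega = - dE, hence 0. *)
Lemma lie_spray_Omega X Y : S (Om X Y) = Om (lie S X) Y + Om X (lie S Y).
Proof.
have sJE Z : S (vfield_fun (J Z) E) =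
    Z (vfield_fun (J S) E) + vfield_fun (J (lie S Z)) E - Z E.
  by apply: (eq_of_subr_eq (hS Z)); rewrite OmegaE; ring.
rewrite !OmegaE; do ?rewrite vfieldE; do ?rewrite vfield_derivE.
by rewrite !sJE jacobi (linearD J); fring.
Qed.

(** Since G = [J, S], the contraction i_G commutes i_J past the Lie derivative along
    S, and both kill Omega. *)
Lemma Omega_barthel X Y : Om (G X) Y + Om X (G Y) = 0.
Proof.
have e := lie_spray_Omega X (J Y).
rewrite (OmegaC X (J Y)) OmegaJC vfieldN lie_spray_Omega in e.
rewrite !barthel_lie !OmegaDl !OmegaDr !OmegaNl !OmegaNr.
rewrite (OmegaJC (lie S X)) (OmegaC (J Y)) (OmegaC X (J _)) (OmegaJC _ X).
by apply: (eq_of_subr_eq e); ring.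
Qed.

(** G is the identity on horizontal fields, so the previous identity reads
    2 Omega(hX, hY) = 0. *)
Lemma Omega_hh X Y : Om (h X) (h Y) = 0.
Proof.
apply: Cslit_double_inj; rewrite addr0.
by rewrite -[RHS](Omega_barthel (h X) (h Y)) !barthel_hproj.
Qed.

Lemma metric0l Y : g 0 Y = 0.
Proof. by rewrite /metric Omega0l. Qed.

Lemma metric0r X : g X 0 = 0.
Proof. by rewrite /metric linear0 OmegaC Omega0l oppr0. Qed.

Lemma metricDl X Y Z : g (X + Y) Z = g X Z + g Y Z.
Proof. exact: OmegaDl. Qed.

Lemma metricDr X Y Z : g X (Y + Z) = g X Y + g X Z.
Proof. by rewrite /metric linearD OmegaDr. Qed.

Lemma metricNl X Z : g (- X) Z = - g X Z.
Proof. exact: OmegaNl. Qed.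

Lemma metricNr X Z : g X (- Z) = - g X Z.
Proof. by rewrite /metric linearN OmegaNr. Qed.

Lemma metric_hJ X Y : g (h X) (J Y) = 0.
Proof. by rewrite /metric -hprojE; exact: Omega_hh. Qed.

Lemma metric_Jh X Y : g (J X) (h Y) = 0.
Proof. by rewrite /metric Fh OmegaNr OmegaJJ oppr0. Qed.

Lemma metric_JJ X Y : g (J X) (J Y) = Om (J X) Y.
Proof.
rewrite /metric -hprojE -[in RHS](hproj_plus_vproj Y) OmegaDr.
by have [U ->] := vproj_imJ Y; rewrite OmegaJJ addr0.
Qed.

Lemma metric_JJC X Y : g (J X) (J Y) = g (J Y) (J X).
Proof. by rewrite !metric_JJ OmegaJC. Qed.

(** A Cartan tensor only sees the class of its argument modulo vertical fields, as
    Omega is nondegenerate and the defining Lie derivatives depend on J X only. *)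
Lemma first_cartan_semibasic T X Y :
  first_cartan_tensor J E F T -> J X = 0 -> T X Y = 0.
Proof.
move=> [_ TE] JX0; apply: Omega_nondegenerate => Z.
rewrite TE JX0 lie_form0 ?scaler0// /Jmetric linear0 ?metric0l//.
exact: metric0r.
Qed.

Lemma second_cartan_semibasic T X Y :
  second_cartan_tensor J E S F T -> J X = 0 -> T X Y = 0.
Proof.
move=> [_ TE] JX0; apply: Omega_nondegenerate => Z.
rewrite TE hprojE JX0 linear0 lie_form0 ?scaler0// ?metric0l//.
exact: metric0r.
Qed.

(** * The horizontal part of the Chern connection *)

Variables (C : vfield M) (T T' : vfield M -> vfield M -> vfield M).
Hypotheses (hT : first_cartan_tensor J E F T).
Hypothesis hT' : second_cartan_tensor J E S F T'.
Variables D0 Dc D : connection M.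
Hypothesis hD0 : berwald J S F D0.
Hypothesis hDc : cartan J S F T T' D0 Dc.
Hypothesis hD : chern J S C g D.

Lemma chern_berwald_diff_imJ X Y :
  exists U, D (h X) (J Y) - v (lie (h X) (J Y)) = J U.
Proof.
case: hD => [[DJ _] _ _ _ _]; rewrite DJ.
have [V ->] := vproj_imJ (lie (h X) (J Y)).
by exists (D (h X) Y - V); rewrite linearB.
Qed.

Let dev X Y := D (h X) (J Y) - v (lie (h X) (J Y)).

(** The antisymmetric part is the difference of the torsions of the Chern and
    Barthel connections on horizontal fields, and both vanish. *)
Lemma chern_berwald_diff_sym X Y : dev X Y = dev Y X.
Proof.
case: hD => [[DJ _] _ _ _ JT]; have e := JT X Y.
rewrite /torsion !linearB /= -!DJ !J_hproj barthel_torsion_free in e.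
rewrite (lieC (J X)) !vprojE hprojN in e.
apply: (eq_of_subr_eq e); rewrite /dev !vprojE.
by move: (hproj J S) => H; vring.
Qed.

(** A Koszul argument. Let a(X, Y, Z) = Omega(dev(X, Y), Z), symmetric in X and Y.
    Since D_hX g = 0 and horizontal and vertical fields are g-orthogonal, the Lie
    derivative that defines T' gives 2 Omega(T'(X, Y), Z) = a(X, Y, Z) + a(X, Z, Y).
    The left-hand side is totally symmetric, and its three cyclic versions solve
    for a(X, Y, Z) = Omega(T'(X, Y), Z). As Omega is nondegenerate, dev = T'. *)
Lemma chern_horizontal X Y : D (h X) (J Y) = v (lie (h X) (J Y)) + T' X Y.
Proof.
have [[_ _ TC _] TE] := hT'.
pose a X Y Z := Om (dev X Y) Z.
have aC X1 Y1 Z1 : a X1 Y1 Z1 = a Y1 X1 Z1 by rewrite /a chern_berwald_diff_sym.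
have ca X1 Y1 Z1 : Om (T' X1 Y1) Z1 + Om (T' X1 Y1) Z1 = a X1 Y1 Z1 + a X1 Z1 Y1.
  have DA W : D (h X1) (J W) - lie (h X1) (J W) = dev X1 W - h (lie (h X1) (J W)).
    by rewrite /dev vprojE; move: (hproj J S) => H; vring.
  have -> : Om (T' X1 Y1) Z1 + Om (T' X1 Y1) Z1 = lie_form (h X1) g (J Y1) (J Z1).
    by rewrite TE -scalerDl -[2^-1]mul1r -splitr scale1r.
  have [_ _ _ Dg _] := hD.
  transitivity (g (dev X1 Y1 - h (lie (h X1) (J Y1))) (J Z1) +
      g (J Y1) (dev X1 Z1 - h (lie (h X1) (J Z1)))).
    rewrite -!DA !metricDl !metricDr !metricNl !metricNr /lie_form Dg; ring.
  have [U UE] : exists U, dev X1 Y1 = J U := chern_berwald_diff_imJ X1 Y1.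
  have [V VE] : exists V, dev X1 Z1 = J V := chern_berwald_diff_imJ X1 Z1.
  rewrite /a UE VE metricDl metricDr metricNl metricNr metric_hJ metric_Jh.
  by rewrite (metric_JJC Y1) !metric_JJ; ring.
have cC X1 Y1 Z1 : Om (T' X1 Y1) Z1 = Om (T' Y1 X1) Z1 by rewrite TC.
have cR X1 Y1 Z1 : Om (T' X1 Y1) Z1 = Om (T' X1 Z1) Y1.
  by apply: Cslit_double_inj; rewrite !ca addrC.
(* With a(X, Y, Z) = p, a(X, Z, Y) = q, a(Y, Z, X) = r, the three cyclic versions
   say that p + q = r + p = q + r is twice the common value. *)
have cE Z : Om (T' X Y) Z = Om (dev X Y) Z.
  have e1 := ca X Y Z; have e2 := ca Y Z X; have e3 := ca Z X Y.
  rewrite (cR Y) cC (aC Y X) in e2; rewrite cC cR (aC Z X) (aC Z Y) in e3.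
  apply: Cslit_double_inj; rewrite -/(a X Y Z).
  have -> : a X Y Z + a X Y Z =
      (a X Y Z + a X Z Y) + (a Y Z X + a X Y Z) - (a X Z Y + a Y Z X) by ring.
  by rewrite -e1 -e2 -e3 addrK.
suff -> : T' X Y = dev X Y by rewrite /dev addrC subrK.
apply/eqP; rewrite -subr_eq0; apply/eqP.
by apply: Omega_nondegenerate => Z; rewrite OmegaDl OmegaNl cE subrr.
Qed.

(** * Curvatures *)

(** On vertical fields the connection is J[JX, Y], and its flatness is the Jacobi
    identity: the bracket [JX, JY] is itself some J W. *)
Lemma chern_v_curvature X Y Z : v_curvature J D X Y Z = 0.
Proof.
have [_ _ DJJ _ _] := hD.
rewrite /v_curvature /curvature !DJJ.
have [W WE] := vertical_imJP (vertical_lieJJ X Y).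
rewrite [in D (lie _ _)]WE DJJ -WE jacobi linearD.
by rewrite addrK subrr.
Qed.

(** The Chern and Cartan connections agree in horizontal directions, so the
    curvatures differ only through the vertical part J U of [hX, hY], by T(U, Z);
    and F applied to the curvature - J U of the Barthel connection is - h U. *)
Lemma chern_h_curvature X Y Z :
  h_curvature J S D X Y Z =
  h_curvature J S Dc X Y Z - T (F (barthel_curvature J S X Y)) Z.
Proof.
have [_ _ DJJ _ _] := hD; have [D0J D0h _] := hD0; have [DcJ Dch _] := hDc.
have [[TDl _ _ _] _] := hT; have [[_ _ _ Tv'] _] := hT'.
have DhE X1 Y1 : D (h X1) (J Y1) = Dc (h X1) (J Y1).
  by rewrite chern_horizontal Dch D0h.
have DhJ X1 Y1 : exists U, Dc (h X1) (J Y1) = J U.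
  have [U UE] := vproj_imJ (lie (h X1) (J Y1)).
  have [V VE] := vertical_imJP (Tv' X1 Y1).
  by exists (U + V); rewrite Dch D0h UE VE linearD.
rewrite /h_curvature /curvature barthel_curvatureE.
have [U UE brE] := bracket_split (h X) (h Y).
rewrite UE brE linearN -hprojE !DhE.
have [[V VE] [W WE]] := (DhJ X Z, DhJ Y Z).
rewrite VE WE !DhE !conn_addl DhE DJJ DcJ D0J.
have -> : T (- h U) Z = - T U Z.
  have Tadd A B : T (A + B) Z = T A Z + T B Z.
    by have := TDl Z 1 A B; rewrite !scale1r.
  apply/eqP; rewrite -addr_eq0 -Tadd.
  apply/eqP/(first_cartan_semibasic _ hT).
  by rewrite linearD linearN /= J_hproj addNr.
vring.
Qed.

(** Expanding with D_hX = D0_hX + T'(X, .) and D = D0 in vertical directions leaves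
    three terms in T'. They form the covariant derivative of T' because
    J(D_JY Z) = J[JY, Z] and J(D_JY X) = J[JY, hX], and T' is semibasic. *)
Lemma chern_hv_curvature X Y Z :
  hv_curvature J S D X Y Z =
  hv_curvature J S D0 X Y Z - cov_tensor D T' (J Y) X Z.
Proof.
have [[DJ _] _ DJJ _ _] := hD; have [D0J D0h _] := hD0.
have [[TDl' _ TC' _] _] := hT'.
have DhE X1 Y1 : D (h X1) (J Y1) = D0 (h X1) (J Y1) + T' X1 Y1.
  by rewrite chern_horizontal D0h.
have Tadd A B W : T' (A + B) W = T' A W + T' B W.
  by have := TDl' W 1 A B; rewrite !scale1r.
have T'J A B W : J A = J B -> T' A W = T' B W.
  move=> AB; rewrite -(subrK B A) Tadd.
  by rewrite (second_cartan_semibasic _ hT') ?add0r// linearB AB subrr.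
rewrite /hv_curvature /curvature /cov_tensor.
have [U UE brE] := bracket_split (h X) (J Y).
rewrite brE !conn_addl !DhE !DJJ !D0J DhE conn_additive.
have [V VE] := vproj_imJ (lie (h X) (J Z)).
rewrite !D0h VE DJJ D0J.
have -> : T' (D (J Y) X) Z = - T' (lie (h X) (J Y)) Z.
  apply/eqP; rewrite -addr_eq0 -Tadd; apply/eqP.
  apply: (second_cartan_semibasic _ hT').
  by rewrite linearD /= -DJ -(J_hproj X) DJJ lieC linearN addNr.
have -> : T' X (D (J Y) Z) = T' X (lie (J Y) Z).
  by rewrite !(TC' X); apply: T'J; rewrite -DJ DJJ.
vring.
Qed.

End FinslerSpace.

Theorem proposition4p4 (R : realType) (n : nat) (M : manifold R n)
  (J : {linear vfield M -> vfield M}) (hJ : vertical_endomorphism J)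
  (C : vfield M) (hC : liouville C)
  (E : finsler_energy J C)
  (S : vfield M) (hS : canonical_spray J E S)
  (F : {linear vfield M -> vfield M}) (hF : almost_complex J S F)
  (T T' : vfield M -> vfield M -> vfield M)
  (hT : first_cartan_tensor J E F T)
  (hT' : second_cartan_tensor J E S F T')
  (Dberwald Dcartan Dchern : connection M)
  (hDberwald : berwald J S F Dberwald)
  (hDcartan : cartan J S F T T' Dberwald Dcartan)
  (hDchern : chern J S C (metric J E F) Dchern) :
  [/\ (forall X Y Z : vfield M,
         h_curvature J S Dchern X Y Z =
         h_curvature J S Dcartan X Y Z - T (F (barthel_curvature J S X Y)) Z),
      (forall X Y Z : vfield M,
         hv_curvature J S Dchern X Y Z =
         hv_curvature J S Dberwald X Y Z - cov_tensor Dchern T' (J Y) X Z) &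
      (forall X Y Z : vfield M, v_curvature J Dchern X Y Z = 0)].
Proof.
have rankE : maximal_rank J E by exact: energy_rank.
split=> X Y Z.
- exact: (chern_h_curvature hJ hF hS rankE hT hT' hDberwald hDcartan hDchern).
- exact: (chern_hv_curvature hJ hF hS rankE hT' hDberwald hDchern).
- exact: (chern_v_curvature hJ hF hDchern).
Qed.
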